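(* Let $X_1,\dots,X_n$ be i.i.d. from $P$ on $\mathcal X=[0,1]^r$ with cdf $F$ and bounded density $p$. Let $\rho$ be a distance between distribution functions on $\mathcal X$ that satisfies the triangle inequality, and suppose there is a sequence $\epsilon_n\to0$ and a constant $c>1$ with $\mathbb P(\rho(F,\hat F_X)>\epsilon_n/16)=O(n^{-c})$. Let $Z=(Z_1,\dots,Z_k)$ be drawn from the exponential mechanism $h(z\mid X)$ based on $\rho$. Then $$\mathbb P(\rho(F,\hat F_Z)>\epsilon_n)\le\frac{(\sup_x p(x))^k\exp\big(-\frac{3\alpha\epsilon_n}{16\Delta_{n,k}}\big)}{R(k,\epsilon_n/2)}+O\Big(\frac1{n^c}\Big).$$
   Context: $\delta(x,y)=\#\{i:x_i\ne y_i\}$ is the Hamming distance between databases. For $u\in\mathcal X^\ell$, $\hat F_u$ denotes the empirical cdf of $u_1,\dots,u_\ell$. Exponential mechanism based on $\rho$: with $\alpha>0$ and $\Delta_{n,k}=\sup_{x,y\in\mathcal X^n,\delta(x,y)=1}\sup_{z\in\mathcal X^k}|\rho(\hat F_x,\hat F_z)-\rho(\hat F_y,\hat F_z)|$, the output $Z\in\mathcal X^k$ has density (w.r.t. Lebesgue measure on $\mathcal X^k$) $h(z\mid x)=g_x(z)/\int_{\mathcal X^k}g_x(s)\,ds$ where $g_x(z)=\exp\big(-\alpha\rho(\hat F_x,\hat F_z)/(2\Delta_{n,k})\big)$. Small ball probability: $R(k,\epsilon)=P^k(\rho(F,\hat G)\le\epsilon)$ where $\hat G$ is the empirical cdf of an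 i.i.d. sample of size $k$ from $P$. $\mathbb P$ denotes the joint probability over $X\sim P^n$ and $Z\sim h(\cdot\mid X)$. *)

(* Defs.v *)
From HB Require Import structures.
From mathcomp Require Import all_boot all_order all_algebra.
From mathcomp Require Import all_classical all_reals all_analysis.
Set Implicit Arguments. Unset Strict Implicit. Unset Printing Implicit Defensive.
Import Order.TTheory GRing.Theory Num.Theory.
Import numFieldNormedType.Exports.
Local Open Scope classical_set_scope.
Local Open Scope ring_scope.

Section DPDefs.
Variable R : realType.

Fixpoint tint (T : Type) (I : (T -> \bar R) -> \bar R) (m : nat)
  : (m.-tuple T -> \bar R) -> \bar R :=
  match m return (m.-tuple T -> \bar R) -> \bar R with
  | 0 => fun f => f [tuple]
  | m'.+1 => fun f =>
      I (fun t => @tint T I m' (fun s : m'.-tuple T => f [tuple of t :: s]))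
  end.

Definition cube_int (r : nat) (f : r.-tuple R -> \bar R) : \bar R :=
  @tint R (fun g => (\int[lebesgue_measure]_(t in `[0%R, 1%R]) g t)%E) r f.

Definition cubes_int (r n : nat) (f : n.-tuple (r.-tuple R) -> \bar R) : \bar R :=
  @tint (r.-tuple R) (@cube_int r) n f.

Definition in_cube (r : nat) (v : r.-tuple R) : Prop :=
  forall i : 'I_r, 0 <= tnth v i <= 1.

Definition in_cubes (r n : nat) (x : n.-tuple (r.-tuple R)) : Prop :=
  forall i : 'I_n, in_cube (tnth x i).

Definition leqv (r : nat) (v t : r.-tuple R) : bool :=
  [forall i : 'I_r, tnth v i <= tnth t i].

Definition ecdf (r l : nat) (u : l.-tuple (r.-tuple R)) : r.-tuple R -> R :=
  fun t => (count (fun v => leqv v t) u)%:R / l%:R.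

Definition hamming (T : eqType) (n : nat) (x y : n.-tuple T) : nat :=
  #|[pred i : 'I_n | tnth x i != tnth y i]|.

Definition is_cdf (r : nat) (G : r.-tuple R -> R) : Prop :=
  exists mu : probability (r.-tuple R) R,
    mu [set v | in_cube v] = 1%E /\
    forall t, G t = fine (mu [set v | leqv v t]).

Definition cdf_of_density (r : nat) (p : r.-tuple R -> R) : r.-tuple R -> R :=
  fun t => fine (cube_int (fun x => (p x * (leqv x t)%:R)%:E)).

Definition prod_dens (r n : nat) (p : r.-tuple R -> R) (x : n.-tuple (r.-tuple R)) : R :=
  \prod_(i < n) p (tnth x i).

Definition sample_prob (r n : nat) (p : r.-tuple R -> R)
    (A : n.-tuple (r.-tuple R) -> bool) : \bar R :=
  cubes_int (fun x => (prod_dens p x * (A x)%:R)%:E).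

Definition small_ball (r : nat) (p : r.-tuple R -> R)
    (rho : (r.-tuple R -> R) -> (r.-tuple R -> R) -> R) (k : nat) (eps : R) : \bar R :=
  sample_prob p (fun z : k.-tuple (r.-tuple R) =>
                   rho (cdf_of_density p) (ecdf z) <= eps).

Definition sens_set (r : nat) (rho : (r.-tuple R -> R) -> (r.-tuple R -> R) -> R)
    (n k : nat) : set R :=
  [set d | exists (x y : n.-tuple (r.-tuple R)) (z : k.-tuple (r.-tuple R)),
     [/\ in_cubes x, in_cubes y, in_cubes z, hamming x y = 1%N &
         d = `|rho (ecdf x) (ecdf z) - rho (ecdf y) (ecdf z)|]].

Definition sensitivity (r : nat) (rho : (r.-tuple R -> R) -> (r.-tuple R -> R) -> R)
    (n k : nat) : R := sup (sens_set rho n k).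

Definition mech_g (r : nat) (rho : (r.-tuple R -> R) -> (r.-tuple R -> R) -> R)
    (alpha : R) (n k : nat) (x : n.-tuple (r.-tuple R)) (z : k.-tuple (r.-tuple R)) : R :=
  expR (- (alpha * rho (ecdf x) (ecdf z)) / (2 * sensitivity rho n k)).

Definition mech_h (r : nat) (rho : (r.-tuple R -> R) -> (r.-tuple R -> R) -> R)
    (alpha : R) (n k : nat) (x : n.-tuple (r.-tuple R)) (z : k.-tuple (r.-tuple R))
    : \bar R :=
  ((mech_g rho alpha x z)%:E /
     cubes_int (fun s : k.-tuple (r.-tuple R) => (mech_g rho alpha x s)%:E))%E.

Definition joint_prob (r : nat) (p : r.-tuple R -> R)
    (rho : (r.-tuple R -> R) -> (r.-tuple R -> R) -> R) (alpha : R) (n k : nat)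
    (B : k.-tuple (r.-tuple R) -> bool) : \bar R :=
  cubes_int (fun x : n.-tuple (r.-tuple R) =>
    ((prod_dens p x)%:E *
      cubes_int (fun z : k.-tuple (r.-tuple R) =>
        mech_h rho alpha x z * (B z)%:R%:E))%E).

End DPDefs.

(* Main.v *)
Require Import Defs.
From HB Require Import structures.
From mathcomp Require Import all_boot all_order all_algebra.
From mathcomp Require Import all_classical all_reals all_analysis.
From mathcomp Require Import measurable_realfun.
From mathcomp Require Import ring lra.
Import Order.TTheory GRing.Theory Num.Theory.
Import numFieldNormedType.Exports.
Local Open Scope classical_set_scope.
Local Open Scope ring_scope.

(** The iterated integrals of [Defs] are integrals against probability measures
    on tuples (Fubini-Tonelli), so they can be manipulated as expectations.

    Write [b = alpha / (2 Delta)] and [a = rho F (ecdf x)].  By the triangle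
    inequality the unnormalized density [exp (- b rho (ecdf x) (ecdf z))] is at least
    [exp (- b (a + eps / 2))] on the ball [rho F (ecdf z) <= eps / 2], whose
    Lebesgue measure is at least [R(k, eps / 2) / (sup p)^k]; this bounds the
    normalizing constant from below.  If [a <= eps / 16], it is at
    most [exp (- 15 b eps / 16)] where [rho F (ecdf z) > eps], and
    [15 / 16 - 9 / 16 = 3 / 8] gives the exponent of the first term.  The samples
    with [a > eps / 16] contribute at most their probability. *)

Set Implicit Arguments.
Unset Strict Implicit.

(** * Expectation functionals and their representing measures *)

Definition monotone_on {R : realType} {T : Type} (D : set T)
    (I : (T -> \bar R) -> \bar R) : Prop :=
  forall f g : T -> \bar R,
    (forall x, D x -> 0 <= f x <= g x)%E -> (I f <= I g)%E.

Definition represents {R : realType} {d : measure_display}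
    {T : measurableType d} (mu : probability T R)
    (I : (T -> \bar R) -> \bar R) : Prop :=
  forall f : T -> \bar R, measurable_fun setT f -> (forall x, 0 <= f x)%E ->
    I f = (\int[mu]_x f x)%E.

(** Monotonicity is a separate clause because [represents] speaks only of measurable integrands. It
    also compares integrands whose measurability has not been established, and makes values outside
    [D] irrelevant. *)
Definition is_mean {R : realType} {d : measure_display}
    {T : measurableType d} (D : set T) (I : (T -> \bar R) -> \bar R) : Prop :=
  [/\ measurable D, monotone_on D I &
      exists mu : probability T R, represents mu I].

(* The library version requires both functions to be measurable. *)
Lemma ge0_le_integral_nomeas (R : realType) (d : measure_display)
    (T : measurableType d) (mu : {measure set T -> \bar R}) (D : set T)
    (f g : T -> \bar R) :
  (forall x, D x -> 0 <= f x <= g x)%E ->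
  (\int[mu]_(x in D) f x <= \int[mu]_(x in D) g x)%E.
Proof.
move=> fg.
have f0 x : D x -> (0 <= f x)%E by move=> /fg /andP[].
have g0 x : D x -> (0 <= g x)%E by move=> /fg /andP[]; exact: le_trans.
(* Both integrals are suprema over simple functions below the integrand, and those below [f] are
   also below [g]. *)
rewrite !ge0_integralE//; apply: le_ereal_sup => _ /= [h hf <-]; exists h => //.
move=> x /=; apply: (le_trans (hf x)); rewrite /patch; case: ifPn => //.
by rewrite inE => /fg /andP[].
Qed.

Lemma probability_integral_cst (R : realType) (d : measure_display)
    (T : measurableType d) (mu : probability T R) (a : \bar R) :
  (\int[mu]_x (cst a) x = a)%E.
Proof.
rewrite integral_cst// [X in (_ * X)%E](_ : _ = 1%E) ?mule1//.
exact: probability_setT.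
Qed.

(** Normalizing a measure of mass 1 leaves it unchanged, and [mnormalize] carries the probability
    structure; the Dirac mass is only its fallback for total mass 0 or infinity. *)
Lemma probability_of_measure (R : realType) (d : measure_display)
    (T : measurableType d) (m : {measure set T -> \bar R}) :
  m setT = 1%E -> exists nu : probability T R, nu = m :> (set T -> \bar R).
Proof.
move=> m1; exists (mnormalize m (dirac point)); apply/funext => A.
by rewrite /= /mnormalize m1 onee_eq0 /= invr1 mule1.
Qed.

Lemma probability_of_density (R : realType) (d : measure_display)
    (T : measurableType d) (mu : {measure set T -> \bar R}) (q : T -> \bar R) :
  measurable_fun setT q -> (forall x, 0 <= q x)%E -> (\int[mu]_x q x = 1)%E ->
  exists nu : probability T R, forall A, nu A = (\int[mu]_(x in A) q x)%E.
Proof.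
move=> mq q0 q1; pose nu A := (\int[mu]_(x in A) q x)%E.
have nu0 : nu set0 = 0%E by rewrite /nu integral_set0.
have nu_ge0 A : (0 <= nu A)%E by apply: integral_ge0 => x _; exact: q0.
have nu_sigma : semi_sigma_additive nu.
  move=> /= F mF tF mUF; rewrite /nu; apply: cvg_toP.
    apply: ereal_nondecreasing_is_cvgn => m n mn.
    by apply: lee_sum_nneg_natr => // k _ _; exact: nu_ge0.
  by rewrite ge0_integral_bigcup//=; exact: measurable_funTS.
pose nuM : {measure set T -> \bar R} :=
  HB.pack nu (isMeasure.Build _ _ _ nu nu0 nu_ge0 nu_sigma).
by have [nuP nuPE] := probability_of_measure (m := nuM) q1; exists nuP; rewrite nuPE.
Qed.

(** * Calculus of expectations on a domain *)

Section mean.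
Context {R : realType} {d : measure_display} {T : measurableType d}.
Context {D : set T} {I : (T -> \bar R) -> \bar R} (mI : is_mean D I).

Lemma mean_measurable_domain : measurable D.
Proof. by case: mI. Qed.

Lemma mean_le (f g : T -> \bar R) :
  (forall x, D x -> 0 <= f x)%E -> (forall x, D x -> f x <= g x)%E ->
  (I f <= I g)%E.
Proof.
case: mI => _ mono _ f0 fg; apply: mono => x Dx.
by apply/andP; split; [exact: f0|exact: fg].
Qed.

Lemma mean_eq (f g : T -> \bar R) :
  (forall x, D x -> 0 <= f x)%E -> (forall x, D x -> f x = g x)%E -> I f = I g.
Proof.
move=> f0 fg; apply/eqP; rewrite eq_le !mean_le// => x Dx; rewrite -fg//.
exact: f0.
Qed.

Lemma mean_cst (a : \bar R) : (0 <= a)%E -> I (cst a) = a.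
Proof.
case: mI => _ _ [mu Imu] a0.
by rewrite Imu// probability_integral_cst.
Qed.

Lemma mean_ge0 (f : T -> \bar R) :
  (forall x, D x -> 0 <= f x)%E -> (0 <= I f)%E.
Proof. by move=> f0; rewrite -(mean_cst (lexx _)); exact: mean_le. Qed.

(** Setting the integrand to 0 outside [D] turns measurability and positivity on [D] into global
    properties, so that the representing measure can be used. *)
Lemma mean_patch (f : T -> \bar R) :
  (forall x, D x -> 0 <= f x)%E -> I f = I (f \_ D).
Proof.
by move=> f0; apply: mean_eq => // x Dx; rewrite /patch mem_set.
Qed.

Let patch_ge0 (f : T -> \bar R) :
  (forall x, D x -> 0 <= f x)%E -> forall x, (0 <= (f \_ D) x)%E.
Proof. by move=> f0 x; rewrite /patch; case: ifPn => //; rewrite inE => /f0. Qed.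

Let measurable_patch (f : T -> \bar R) :
  measurable_fun D f -> measurable_fun setT (f \_ D).
Proof. by move=> mf; apply/(measurable_restrictT f mean_measurable_domain). Qed.

Lemma meanZ (a : \bar R) (f : T -> \bar R) : (0 <= a)%E ->
  measurable_fun D f -> (forall x, D x -> 0 <= f x)%E ->
  I (fun x => a * f x)%E = (a * I f)%E.
Proof.
case: (mI) => mD _ [mu Imu] a0 mf f0.
have af0 x : D x -> (0 <= a * f x)%E by move=> /f0 fx; exact: mule_ge0.
rewrite (mean_patch af0) (mean_patch f0) !Imu//.
- rewrite -ge0_integralZl//.
  + apply: eq_integral => x _; rewrite /patch; case: ifPn => //.
    by rewrite mule0.
  + exact: measurable_patch.
  + by move=> x _; exact: patch_ge0.
- exact: measurable_patch.
- exact: patch_ge0.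
- by apply: measurable_patch; exact: emeasurable_funM.
- exact: patch_ge0.
Qed.

Lemma meanD (f g : T -> \bar R) :
  measurable_fun D f -> (forall x, D x -> 0 <= f x)%E ->
  measurable_fun D g -> (forall x, D x -> 0 <= g x)%E ->
  I (fun x => f x + g x)%E = (I f + I g)%E.
Proof.
case: (mI) => mD _ [mu Imu] mf f0 mg g0.
have fg0 x : D x -> (0 <= f x + g x)%E.
  by move=> Dx; apply: adde_ge0; [exact: f0|exact: g0].
rewrite (mean_patch fg0) (mean_patch f0) (mean_patch g0) !Imu//.
all: try exact: measurable_patch.
all: try exact: patch_ge0.
- rewrite -ge0_integralD//.
  all: try exact: measurable_patch.
  all: try by move=> x _; exact: patch_ge0.
  apply: eq_integral => x _; rewrite /patch; case: ifPn => //.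
  by rewrite adde0.
- by apply: measurable_patch; exact: emeasurable_funD.
Qed.

(** The witness has density [q], extended by 0 off [D], with respect to the measure representing
    [I]. This is how a density yields a distribution function. *)
Lemma mean_density (q : T -> R) :
  measurable_fun D q -> (forall x, D x -> 0 <= q x) ->
  I (fun x => (q x)%:E) = 1%E ->
  exists nu : probability T R, nu D = 1%E /\
    forall A, measurable A -> nu A = I (fun x => (q x * (x \in A)%:R)%:E).
Proof.
case: (mI) => mD _ [mu Imu] mq q0 q1.
pose Q : T -> \bar R := (EFin \o q) \_ D.
have q0' x : D x -> (0 <= (EFin \o q) x)%E by move=> Dx; rewrite lee_fin q0.
have mQ : measurable_fun setT Q.
  by apply: measurable_patch; exact/measurable_EFinP.
have Q0 x : (0 <= Q x)%E by exact: patch_ge0.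
have Q1 : (\int[mu]_x Q x = 1)%E by rewrite -Imu// -mean_patch.
have [nu nuE] := probability_of_density mQ Q0 Q1.
exists nu; split.
  rewrite nuE -Q1 integral_mkcond; apply: eq_integral => x _.
  by rewrite /Q /patch; case: (x \in D).
move=> A mA; rewrite nuE integral_mkcond.
have qA0 x : D x -> (0 <= (q x * (x \in A)%:R)%:E)%E.
  by move=> Dx; rewrite lee_fin mulr_ge0// q0.
rewrite (mean_patch qA0) Imu.
- apply: eq_integral => x _; rewrite /Q /patch /=.
  by case: (x \in D); case: (x \in A); rewrite ?mulr1 ?mulr0.
- apply: measurable_patch; apply/measurable_EFinP; apply: measurable_funM => //.
  by have := @measurable_indic _ _ R D _ mA; exact.
- exact: patch_ge0.
Qed.
End mean.

(** * Iterated integrals over tuples and cubes *)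

Lemma tuple_cons_domain (T : Type) (D : set T) (m : nat) (t : T)
    (s : m.-tuple T) :
  D t -> (forall i, D (tnth s i)) -> forall i, D (tnth [tuple of t :: s] i).
Proof.
move=> Dt Ds i; have [j ->|->] := unliftP ord0 i; last by rewrite tnth0.
by rewrite tnthS.
Qed.

Lemma measurable_tuple_domain (d : measure_display) (T : measurableType d)
    (m : nat) (D : 'I_m -> set T) : (forall i, measurable (D i)) ->
  measurable [set s : m.-tuple T | forall i, D i (tnth s i)].
Proof.
move=> mD; rewrite [X in measurable X](_ : _ =
    \big[setI/setT]_(i < m) ((@tnth m T ^~ i) @^-1` D i)).
  apply: bigsetI_measurable => i _; rewrite -[X in measurable X]setTI.
  exact: measurable_tnth.
rewrite -bigcap_seq; apply/seteqP; split => s /= Ds.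
  by move=> i _ /=; exact: Ds.
by move=> i; apply: Ds; rewrite /= mem_index_enum.
Qed.

(** By induction on [m], the representing measure is the product of [mu] with the one for shorter
    tuples, pushed forward along cons; Tonelli's theorem identifies its integral with the iterated
    one. *)
Lemma tint_mean (R : realType) (d : measure_display) (T : measurableType d)
    (D : set T) (I : (T -> \bar R) -> \bar R) (m : nat) :
  is_mean D I ->
  is_mean [set s : m.-tuple T | forall i, D (tnth s i)] (@tint R T I m).
Proof.
move=> mI; have [mD monoI [mu Imu]] := mI.
elim: m => [|m IHm].
  split.
  - by rewrite [X in measurable X](_ : _ = setT)//; apply/seteqP; split => // s _ [].
  - move=> f g fg /=; have [|//] := andP (fg [tuple] _).
    by case.
  - exists (dirac ([tuple] : 0.-tuple T)) => f mf f0 /=.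
    by rewrite integral_dirac// diracT mul1e.
have [mDm mono [mum Imum]] := IHm.
split.
- exact: (@measurable_tuple_domain _ _ _ (fun=> D)).
- move=> f g fg; apply: (mean_le mI) => t Dt.
    apply: (mean_ge0 IHm) => s Ds.
    by have /andP[] := fg _ (tuple_cons_domain Dt Ds).
  apply: mono => s Ds; exact: fg _ (tuple_cons_domain Dt Ds).
- pose c (ts : T * m.-tuple T) := [tuple of ts.1 :: ts.2].
  have mc : measurable_fun setT c by exact: measurable_cons.
  have push1 : pushforward (mu \x mum)%E c setT = 1%E.
    rewrite /pushforward preimage_setT.
    exact: (probability_setT (mu \x mum)%E).
  pose nuM : {measure set (m.+1.-tuple T) -> \bar R} := pushforward (mu \x mum)%E c.
  have mcons t : measurable_fun setT (fun s : m.-tuple T => [tuple of t :: s]).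
    exact: measurable_cons.
  have [nu nuE] := probability_of_measure (m := nuM mc) push1.
  exists nu => f mf f0.
  have -> : (\int[nu]_x f x = \int[nuM mc]_x f x)%E.
    by apply: eq_measure_integral => A _ _; rewrite -nuE.
  have mfc : measurable_fun setT (f \o c) by exact: measurableT_comp.
  transitivity (\int[(mu \x mum)%E]_z (f \o c) z)%E; last first.
    by rewrite ge0_integral_pushforward//; exact: mc.
  rewrite fubini_tonelli1//= /fubini_F.
  have tintE : (fun t => tint I (fun s => f [tuple of t :: s])) =
      (fun t => \int[mum]_s f [tuple of t :: s])%E.
    by apply/funext => t; rewrite Imum//; exact: measurableT_comp (mcons t).
  rewrite -tintE Imu//.
  + rewrite tintE; have := measurable_fun_fubini_tonelli_F (m2 := mum) _ mfc; apply.
    by move=> z; exact: f0.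
  + by move=> t; exact: (mean_ge0 IHm).
Qed.

Lemma unit_interval_mean (R : realType) :
  is_mean (`[0, 1]%classic : set R)
    (fun g => \int[lebesgue_measure]_(t in `[0%R, 1%R]) g t)%E.
Proof.
split; first exact: measurable_itv.
- by move=> f g fg; exact: ge0_le_integral_nomeas.
(* The uniform law lives on the alias [measurableTypeR R]; pushing it forward along the identity
   moves it to [R]. *)
- pose u : probability (measurableTypeR R) R := uniform_prob (@ltr01 R).
  pose id_ : measurableTypeR R -> R := idfun.
  have mid : measurable_fun setT id_ by exact: measurable_id.
  pose v : {measure set R -> \bar R} := pushforward u id_.
  have v1 : v mid setT = 1%E by exact: (probability_setT u).
  have [nu nuE] := probability_of_measure v1.
  exists nu => f mf f0.
  have -> : (\int[nu]_x f x = \int[v mid]_x f x)%E.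
    by apply: eq_measure_integral => A _ _; rewrite -nuE.
  rewrite ge0_integral_pushforward//.
  have := integral_uniform (@ltr01 R) (f := f).
  rewrite subr0 invr1 mul1e => ->//.
Qed.

Lemma cube_mean (R : realType) (r : nat) :
  is_mean [set x : r.-tuple R | in_cube x] (@cube_int R r).
Proof.
have := tint_mean r (unit_interval_mean R).
rewrite [X in is_mean X](_ : _ = [set x | in_cube x]).
  exact.
by apply/seteqP; split => x /= + i => /(_ i); rewrite in_itv.
Qed.

Lemma cubes_mean (R : realType) (r n : nat) :
  is_mean [set x : n.-tuple (r.-tuple R) | in_cubes x] (@cubes_int R r n).
Proof. exact: tint_mean (cube_mean R r). Qed.

(** * Distribution functions from densities and from samples *)

Lemma measurable_leqv (R : realType) (r : nat) (t : r.-tuple R) :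
  measurable [set v | leqv v t].
Proof.
rewrite [X in measurable X](_ : _ =
    [set v : r.-tuple R | forall i, `]-oo, tnth t i]%classic (tnth v i)]).
  by apply: (measurable_tuple_domain (D := fun i => `]-oo, tnth t i]%classic)).
apply/seteqP; split => v /=.
  by move=> /forallP vt i; rewrite in_itv /= vt.
by move=> vt; apply/forallP => i; have := vt i; rewrite in_itv.
Qed.

Lemma density_is_cdf (R : realType) (r : nat) (p : r.-tuple R -> R) :
  measurable_fun [set x | in_cube x] p ->
  (forall x, in_cube x -> 0 <= p x) ->
  cube_int (fun x => (p x)%:E) = 1%E -> is_cdf (cdf_of_density p).
Proof.
move=> mp p0 p1; have [nu [nu1 nuE]] := mean_density (cube_mean R r) mp p0 p1.
exists nu; split => // t; rewrite nuE; last exact: measurable_leqv.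
congr fine; congr cube_int; apply/funext => x; congr (_ * (nat_of_bool _)%:R)%:E.
by apply/idP/idP; rewrite inE.
Qed.

(** The witness is the average of the Dirac masses at the sample points; it has mass 1 because [l]
    is positive. *)
Lemma ecdf_is_cdf (R : realType) (r l : nat) (u : l.-tuple (r.-tuple R)) :
  (0 < l)%N -> in_cubes u -> is_cdf (ecdf u).
Proof.
move=> l0 uC; have l_neq0 : l%:R != 0 :> R by rewrite pnatr_eq0 -lt0n.
have li0 : 0 <= l%:R^-1 :> R by rewrite invr_ge0.
pose m := mscale (NngNum li0)
  (msum (fun i => dirac (nth point u i) : {measure set _ -> \bar R}) l).
have mE A : m A = ((\sum_(i < l) (\1_A (tnth u i)))%R / l%:R)%:E.
  rewrite /m /= /mscale /= /msum [in RHS]mulrC EFinM; congr (_ * _)%E.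
  rewrite -sumEFin; apply: eq_bigr => i _.
  by rewrite /= diracE indicE (tnth_nth point).
have m1 A : (forall i, A (tnth u i)) -> m A = 1%E.
  move=> uA; rewrite mE (eq_bigr (fun=> 1)) => [|i _].
    by rewrite sumr_const card_ord divff.
  by rewrite indicE mem_set.
have [mu muE] := probability_of_measure (m1 setT (fun _ => I)).
exists mu; split; first by rewrite muE; exact: m1.
move=> t; have muA : mu [set v | leqv v t] =
    ((\sum_(i < l) \1_[set v | leqv v t] (tnth u i)) / l%:R)%:E.
  by rewrite muE; exact: mE.
rewrite muA /ecdf /=; congr (_ / _).
rewrite -sum1_count big_tuple natr_sum big_mkcond /=; apply: eq_bigr => i _.
rewrite indicE; case: ifPn => ut; first by rewrite mem_set.
by rewrite memNset//; exact/negP.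
Qed.

(** * Product densities *)

Section exponential_mechanism.
Context {R : realType} {r : nat} {p : r.-tuple R -> R}.
Hypothesis mp : measurable_fun [set x | in_cube x] p.
Hypothesis p_ge0 : forall x, in_cube x -> 0 <= p x.
Hypothesis p_int : cube_int (fun x => (p x)%:E) = 1%E.
Hypothesis p_bounded : exists M : R, forall x, in_cube x -> p x <= M.

Local Notation S := (sup [set p x | x in [set x | in_cube x]]).
Local Notation F := (cdf_of_density p).

Lemma prod_dens_cons n (t : r.-tuple R) (s : n.-tuple (r.-tuple R)) :
  prod_dens p [tuple of t :: s] = p t * prod_dens p s.
Proof.
rewrite /prod_dens big_ord_recl tnth0; congr (_ * _).
by apply: eq_bigr => i _; rewrite tnthS.
Qed.

Lemma prod_dens_ge0 n (x : n.-tuple (r.-tuple R)) :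
  in_cubes x -> 0 <= prod_dens p x.
Proof. by move=> xC; apply: prodr_ge0 => i _; exact: p_ge0. Qed.

Lemma density_le_sup x : in_cube x -> p x <= S.
Proof.
move=> xC; apply: ub_le_sup; last by exists x.
by have [M pM] := p_bounded; exists M => _ [y yC <-]; exact: pM.
Qed.

Lemma prod_dens_le_sup n (x : n.-tuple (r.-tuple R)) :
  in_cubes x -> prod_dens p x <= S ^+ n.
Proof.
move=> xC; rewrite -[n in S ^+ n]card_ord -prodr_const.
by apply: ler_prod => i _; rewrite p_ge0//= density_le_sup.
Qed.

(** Since [p] is measurable only on the cube, it is replaced by its extension by 0, which gives the
    same product on [in_cubes]. *)
Lemma measurable_prod_dens n :
  measurable_fun [set x : n.-tuple (r.-tuple R) | in_cubes x] (prod_dens p).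
Proof.
have mD := mean_measurable_domain (cube_mean R r).
apply: (@eq_measurable_fun _ _ _ _ _
    (prod_dens (p \_ [set x | in_cube x]))) => [x|].
  rewrite inE => xC; apply: eq_bigr => i _.
  by rewrite patchE mem_set//; exact: xC.
apply: measurable_funTS; apply: measurable_prod => i _ /=.
apply: (@measurableT_comp _ _ _ _ _ _ (p \_ [set x | in_cube x])).
  exact/(measurable_restrictT p mD).
exact: measurable_tnth.
Qed.

Lemma cubes_int_prod_dens n :
  cubes_int (fun x : n.-tuple (r.-tuple R) => (prod_dens p x)%:E) = 1%E.
Proof.
elim: n => [|n IHn]; first by rewrite /cubes_int /= /prod_dens big_ord0.
rewrite -p_int; apply/esym.
apply: (mean_eq (cube_mean R r)) => [t tC|t tC]; first by rewrite lee_fin p_ge0.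
(* For fixed [t] the factor [p t] leaves the inner integral, which equals 1 by induction. *)
rewrite -[LHS]mule1 -IHn -(meanZ (cubes_mean R r n)).
- by congr cubes_int; apply/funext => s; rewrite prod_dens_cons.
- by rewrite lee_fin p_ge0.
- by apply/measurable_EFinP; exact: measurable_prod_dens.
- by move=> s sC; rewrite lee_fin prod_dens_ge0.
Qed.

End exponential_mechanism.

Lemma measurable_fun_boolr (R : realType) (d : measure_display)
    (T : measurableType d) (D : set T) (b : T -> bool) :
  measurable_fun D b -> measurable_fun D (fun x => (b x)%:R : R).
Proof.
by move=> mb; apply: (@measurableT_comp _ _ _ _ _ _ (fun c : bool => c%:R : R)) => //.
Qed.

(** * Tail bounds for the exponential mechanism *)

Section mechanism_bound.
Context {R : realType} {r : nat} {p : r.-tuple R -> R}.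
Context {rho : (r.-tuple R -> R) -> (r.-tuple R -> R) -> R} {alpha : R}.
Hypothesis mp : measurable_fun [set x | in_cube x] p.
Hypothesis p_ge0 : forall x, in_cube x -> 0 <= p x.
Hypothesis p_int : cube_int (fun x => (p x)%:E) = 1%E.
Hypothesis p_bounded : exists M : R, forall x, in_cube x -> p x <= M.
Hypothesis rho_ge0 : forall G H, is_cdf G -> is_cdf H -> 0 <= rho G H.
Hypothesis rho_sym : forall G H, is_cdf G -> is_cdf H -> rho G H = rho H G.
Hypothesis rho_triangle : forall G H K, is_cdf G -> is_cdf H -> is_cdf K ->
  rho G K <= rho G H + rho H K.
Hypothesis rho_measurable : forall (l : nat) G, is_cdf G ->
  measurable_fun [set u : l.-tuple (r.-tuple R) | in_cubes u]
    (fun u => rho G (ecdf u)).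
Hypothesis alpha_gt0 : 0 < alpha.

Local Notation S := (sup [set p x | x in [set x | in_cube x]]).
Local Notation F := (cdf_of_density p).

Let F_cdf : is_cdf F. Proof. exact: density_is_cdf. Qed.

Let S_ge0 m : 0 <= S ^+ m.
Proof.
(* The origin shows that the cube is nonempty, so [S] dominates a nonnegative value of [p]. *)
have oC : in_cube [tuple (0 : R) | j < r] by move=> j; rewrite tnth_mktuple lexx ler01.
by apply: exprn_ge0; exact: le_trans (p_ge0 oC) (density_le_sup p_bounded oC).
Qed.

(* The empirical cdf of an empty database is 0 / 0 = 0, which is not a cdf, so
   nothing is known about [rho F] there and both sides are computed. *)
Lemma mech_far_le0 (n k : nat) (eps : R) (x : n.-tuple (r.-tuple R)) :
  k = 0%N -> 0 < sensitivity rho n k ->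
  (0 < small_ball p rho k (eps / 2))%E ->
  (cubes_int (fun z : k.-tuple (r.-tuple R) =>
     mech_h rho alpha x z * (eps < rho F (ecdf z))%R%:R%:E)
   <= (S ^+ k * expR (- (3 * alpha * eps) / (16 * sensitivity rho n k)))%:E
      / small_ball p rho k (eps / 2))%E.
Proof.
move=> k0; subst k => sens_gt0.
rewrite /small_ball /sample_prob /mech_h /cubes_int /= /prod_dens big_ord0 mul1r.
set z : 0.-tuple (r.-tuple R) := [tuple].
(* Positivity of the small ball probability means that the only possible output, the empty tuple,
   lies in the ball. *)
rewrite lte_fin; case: (boolP (rho F (ecdf z) <= eps / 2)); last by rewrite ltxx.
move=> ball_z _; rewrite inver gt_eqF ?expR_gt0// -EFinM divff ?gt_eqF ?expR_gt0//.
rewrite inver oner_eq0 invr1 mule1 expr0 !mul1r lee_fin.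
have [far_z|_] := boolP (eps < rho F (ecdf z)); last exact: expR_ge0.
(* From [eps < rho <= eps / 2] it follows that [eps] is negative, so the exponential on the right is
   at least 1. *)
have eps_lt0 : eps < 0 by move: ball_z far_z; lra.
rewrite -expR0 ler_expR divr_ge0 ?mulr_ge0 ?(ltW sens_gt0)//.
by rewrite oppr_ge0 pmulr_rle0 ?mulr_gt0// ltW.
Qed.

Section fixed_sizes.
Context {n k : nat} {eps : R}.
Hypothesis n_gt0 : (0 < n)%N.
Hypothesis sens_gt0 : 0 < sensitivity rho n k.
Hypothesis ball_gt0 : (0 < small_ball p rho k (eps / 2))%E.

Local Notation beta := (alpha / (2 * sensitivity rho n k)).
Local Notation ball z := (rho F (ecdf z) <= eps / 2).
Local Notation far z := (eps < rho F (ecdf z)).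
Local Notation bad x := (eps / 16 < rho F (ecdf x)).
Local Notation bound := (S ^+ k *
  expR (- (3 * alpha * eps) / (16 * sensitivity rho n k))).

Let beta_gt0 : 0 < beta. Proof. by rewrite divr_gt0// mulr_gt0. Qed.

Lemma mech_gE (x : n.-tuple (r.-tuple R)) (z : k.-tuple (r.-tuple R)) :
  mech_g rho alpha x z = expR (- (beta * rho (ecdf x) (ecdf z))).
Proof. by rewrite /mech_g mulNr [in RHS]mulrAC. Qed.

Lemma measurable_sample_event (l : nat) (A : l.-tuple (r.-tuple R) -> bool) :
  measurable_fun [set z | in_cubes z] A ->
  measurable_fun [set z | in_cubes z] (fun z => (prod_dens p z * (A z)%:R)%:E).
Proof.
move=> mA; apply/measurable_EFinP; apply: measurable_funM.
  exact: measurable_prod_dens.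
exact: measurable_fun_boolr.
Qed.

Lemma sample_event_ge0 (l : nat) (z : l.-tuple (r.-tuple R)) (b : bool) :
  in_cubes z -> (0 <= (prod_dens p z * b%:R)%:E)%E.
Proof. by move=> zC; rewrite lee_fin mulr_ge0// prod_dens_ge0. Qed.

Lemma measurable_ball l :
  measurable_fun [set z : l.-tuple (r.-tuple R) | in_cubes z] (fun z => ball z).
Proof. by apply: measurable_fun_ler => //; exact: rho_measurable. Qed.

Lemma measurable_bad l :
  measurable_fun [set z : l.-tuple (r.-tuple R) | in_cubes z] (fun z => bad z).
Proof. by apply: measurable_fun_ltr => //; exact: rho_measurable. Qed.

(** Comparison with the total mass of the product density bounds this probability by 1, so dividing
    by it is real arithmetic. *)
Lemma small_ball_fin : exists2 b : R, 0 < b & small_ball p rho k (eps / 2) = b%:E.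
Proof.
have ball_le1 : (small_ball p rho k (eps / 2) <= 1)%E.
  rewrite -(cubes_int_prod_dens mp p_ge0 p_int k).
  apply: (mean_le (cubes_mean R r k)) => z zC; first exact: sample_event_ge0.
  by rewrite lee_fin ler_piMr ?(prod_dens_ge0 p_ge0)//; case: (ball z).
move: ball_gt0 ball_le1; case: small_ball => // b b0 _.
by exists b.
Qed.

(** * Nonempty outputs, whose empirical cdf is a genuine cdf *)

Section positive_output.
Hypothesis k_gt0 : (0 < k)%N.
Context {x : n.-tuple (r.-tuple R)}.
Hypothesis xC : in_cubes x.

Let x_cdf : is_cdf (ecdf x). Proof. exact: ecdf_is_cdf. Qed.
Let z_cdf (z : k.-tuple (r.-tuple R)) : in_cubes z -> is_cdf (ecdf z).
Proof. exact: ecdf_is_cdf. Qed.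

Let measurable_mech_g : measurable_fun [set z | in_cubes z]
  (fun z : k.-tuple (r.-tuple R) => (mech_g rho alpha x z)%:E).
Proof.
apply/measurable_EFinP; rewrite (_ : mech_g rho alpha x =
    fun z => expR (- (beta * rho (ecdf x) (ecdf z)))).
  apply: measurableT_comp => //.
  apply: measurableT_comp => //; apply: measurable_funM => //.
  exact: rho_measurable.
by apply/funext => z; exact: mech_gE.
Qed.

(** On the ball the unnormalized density is at least [e1] and the product density is at most
    [S ^+ k]. Multiplying these bounds and integrating gives the last inequality. *)
Lemma mech_g_int :
  exists z b : R, [/\ 0 < z, 0 < b,
    cubes_int (fun s : k.-tuple (r.-tuple R) => (mech_g rho alpha x s)%:E) = z%:E,
    small_ball p rho k (eps / 2) = b%:E &
    expR (- (beta * (rho F (ecdf x) + eps / 2))) * b <= S ^+ k * z].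
Proof.
have Sk_ge0 := S_ge0 k.
have [b b0 bE] := small_ball_fin.
have mk := cubes_mean R r k.
have g0 (s : k.-tuple (r.-tuple R)) : (0 <= (mech_g rho alpha x s)%:E)%E.
  by rewrite lee_fin expR_ge0.
set e1 := expR _.
have g_le1 : (cubes_int (fun s : k.-tuple (r.-tuple R) => (mech_g rho alpha x s)%:E) <= 1)%E.
  rewrite -(mean_cst mk lee01); apply: (mean_le mk) => // s sC /=.
  rewrite lee_fin mech_gE expR_le1 oppr_le0 mulr_ge0//; first exact: ltW.
  by apply: rho_ge0 => //; exact: z_cdf.
have SZ : (e1%:E * b%:E <=
    (S ^+ k)%:E * cubes_int (fun s : k.-tuple (r.-tuple R) => (mech_g rho alpha x s)%:E))%E.
  rewrite -bE /small_ball /sample_prob -(meanZ mk) ?lee_fin ?expR_ge0//; last 2 first.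
    exact: (@measurable_sample_event k _ (@measurable_ball k)).
    by move=> *; exact: sample_event_ge0.
  rewrite -(meanZ mk)//.
  apply: (mean_le mk) => s sC.
    by rewrite mule_ge0 ?lee_fin ?expR_ge0//; exact: sample_event_ge0.
  rewrite -!EFinM lee_fin; have [sball|_] := boolP (ball s); last first.
    by rewrite !mulr0 mulr_ge0// expR_ge0.
  rewrite mulr1 mulrC ler_pM ?prod_dens_ge0 ?expR_ge0 ?prod_dens_le_sup//.
  rewrite mech_gE ler_expR lerN2 ler_pM2l//.
  rewrite (le_trans (rho_triangle x_cdf F_cdf (z_cdf sC)))// lerD//.
  by rewrite rho_sym.
have : (0 <= cubes_int (fun s : k.-tuple (r.-tuple R) => (mech_g rho alpha x s)%:E))%E.
  by apply: (mean_ge0 mk).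
move: g_le1 SZ; case: cubes_int => // z _; rewrite -!EFinM !lee_fin => zb z0.
exists z, b; split => //; rewrite lt_neqAle z0 andbT eq_sym.
(* A zero normalizing constant would give [e1 * b <= 0]. *)
by apply: contraTneq zb => ->; rewrite mulr0 -ltNge mulr_gt0// expR_gt0.
Qed.

(** Dropping the indicator leaves the total mass of the mechanism's density. This trivial bound
    serves the databases far from [F]. *)
Lemma mech_far_le1 :
  (cubes_int (fun z : k.-tuple (r.-tuple R) => mech_h rho alpha x z * (far z)%:R%:E) <= 1)%E.
Proof.
have [Z [b [Z0 b0 ZE bE _]]] := mech_g_int.
have mk := cubes_mean R r k.
have hE (z : k.-tuple (r.-tuple R)) : mech_h rho alpha x z = (Z^-1%:E * (mech_g rho alpha x z)%:E)%E.
  by rewrite /mech_h ZE inver gt_eqF// muleC.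
apply: (@le_trans _ _ (cubes_int (fun z : k.-tuple (r.-tuple R) => Z^-1%:E * (mech_g rho alpha x z)%:E)%E)).
  apply: (mean_le mk) => z zC; rewrite hE -!EFinM lee_fin.
    by rewrite !mulr_ge0// ?expR_ge0// invr_ge0 ltW.
  by rewrite ler_piMr ?mulr_ge0 ?expR_ge0 ?invr_ge0 ?(ltW Z0)//; case: (far z).
rewrite (meanZ mk) ?lee_fin ?invr_ge0 ?(ltW Z0)//; last first.
  by move=> z _; rewrite lee_fin expR_ge0.
by rewrite ZE -EFinM mulVf ?gt_eqF.
Qed.

Lemma mech_far_le_bound : ~~ bad x ->
  (cubes_int (fun z : k.-tuple (r.-tuple R) => mech_h rho alpha x z * (far z)%:R%:E)
    <= bound%:E / small_ball p rho k (eps / 2))%E.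
Proof.
rewrite -leNgt => x_good.
have [Z [b [Z0 b0 ZE bE Zb]]] := mech_g_int.
have mk := cubes_mean R r k.
have bound0 : 0 <= bound / b by rewrite divr_ge0 ?mulr_ge0 ?expR_ge0 ?(ltW b0).
(* The cube has volume 1, so a pointwise bound on the integrand suffices. *)
rewrite bE inver gt_eqF// -EFinM -(mean_cst mk (a := (bound / b)%:E)) ?lee_fin//.
apply: (mean_le mk) => z zC; rewrite /mech_h ZE inver gt_eqF// -!EFinM lee_fin.
  by rewrite !mulr_ge0// ?expR_ge0// invr_ge0 ltW.
have [zfar|_] := boolP (far z); last by rewrite mulr0.
rewrite mulr1 ler_pdivrMr// mulrAC ler_pdivlMr//.
(* By the triangle inequality, the distance from [ecdf x] to [ecdf z] exceeds [eps - eps / 16]. *)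
have g_le : mech_g rho alpha x z <= expR (- (beta * (15 / 16 * eps))).
  rewrite mech_gE ler_expR lerN2 ler_pM2l//.
  have := rho_triangle F_cdf x_cdf (z_cdf zC).
  by move: zfar x_good; lra.
apply: (le_trans (ler_wpM2r (ltW b0) g_le)).
rewrite [leRHS]mulrAC.
apply: le_trans (ler_wpM2r (expR_ge0 _) Zb).
rewrite [leRHS]mulrAC -expRD ler_pM2r// ler_expR.
rewrite mulNr -opprD lerN2 (_ : 3 * alpha * eps / _ = beta * (3 / 8 * eps)); last first.
  by field; rewrite gt_eqF//.
(* As [15 / 16 - 3 / 8 - 1 / 2 = 1 / 16], the remaining inequality is exactly
   [rho F (ecdf x) <= eps / 16]. *)
rewrite -mulrDr ler_pM2l//; move: x_good; lra.
Qed.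

End positive_output.

(** Adding the indicator of [bad x] merges both cases into one bound valid for every database, ready
    to be averaged over the sample. *)
Lemma mech_far_le (x : n.-tuple (r.-tuple R)) : in_cubes x ->
  (cubes_int (fun z : k.-tuple (r.-tuple R) =>
     mech_h rho alpha x z * (far z)%:R%:E)
   <= bound%:E / small_ball p rho k (eps / 2) + (bad x)%:R%:E)%E.
Proof.
move=> xC; have Sk_ge0 := S_ge0 k.
have [b b0 bE] := small_ball_fin.
have bound0 : (0 <= bound%:E / small_ball p rho k (eps / 2))%E.
  by rewrite bE inver gt_eqF// -EFinM lee_fin divr_ge0 ?mulr_ge0 ?expR_ge0 ?(ltW b0).
have [k0|k_gt0] := posnP k; last first.
  have [x_bad|x_good] := boolP (bad x).
    by apply: (le_trans (mech_far_le1 k_gt0 xC)); rewrite leeDr.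
  by rewrite adde0; exact: mech_far_le_bound.
by apply: le_trans (mech_far_le0 x k0 sens_gt0 ball_gt0) _; rewrite leeDl.
Qed.



Lemma joint_prob_le :
  (joint_prob p rho alpha n (fun z : k.-tuple (r.-tuple R) => far z)
   <= bound%:E / small_ball p rho k (eps / 2)
      + sample_prob p (fun x : n.-tuple (r.-tuple R) => bad x))%E.
Proof.
have Sk_ge0 := S_ge0 k.
have [b b0 bE] := small_ball_fin.
set K := (bound%:E / _)%E.
have K0 : (0 <= K)%E.
  by rewrite /K bE inver gt_eqF// -EFinM lee_fin divr_ge0 ?mulr_ge0 ?expR_ge0 ?(ltW b0).
have mn := cubes_mean R r n.
have mq : measurable_fun [set x | in_cubes x]
    (fun x : n.-tuple (r.-tuple R) => (prod_dens p x)%:E).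
  by apply/measurable_EFinP; exact: measurable_prod_dens.
have q0 (x : n.-tuple (r.-tuple R)) : in_cubes x -> (0 <= (prod_dens p x)%:E)%E.
  by move=> xC; rewrite lee_fin prod_dens_ge0.
(* Writing [K] as [K] times the mass of the product density turns the right side into a single
   integral over samples, to be compared pointwise. *)
rewrite -[K]mule1 -(cubes_int_prod_dens mp p_ge0 p_int n) -(meanZ mn)//.
rewrite /sample_prob -(meanD mn); last 4 first.
- by apply: emeasurable_funM.
- by move=> x xC; rewrite mule_ge0// q0.
- exact: (@measurable_sample_event n _ (@measurable_bad n)).
- by move=> x xC; exact: sample_event_ge0.
apply: (mean_le mn) => x xC.
  apply: mule_ge0; first exact: q0.
  apply: (mean_ge0 (cubes_mean R r k)) => z zC.
  rewrite mule_ge0 ?lee_fin// mule_ge0 ?lee_fin ?expR_ge0// inve_ge0.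
  by apply: (mean_ge0 (cubes_mean R r k)) => s sC; rewrite lee_fin expR_ge0.
rewrite EFinM [(K * _)%E]muleC -ge0_muleDr//.
by apply: lee_wpmul2l; [exact: q0|exact: mech_far_le].
Qed.

End fixed_sizes.
End mechanism_bound.

Unset Implicit Arguments.

Theorem mainTheorem9 (R : realType) (r : nat) (p : r.-tuple R -> R)
    (rho : (r.-tuple R -> R) -> (r.-tuple R -> R) -> R)
    (eps : nat -> R) (c alpha : R) (kn : nat -> nat) :
  (* p is a bounded probability density on X = [0,1]^r *)
  measurable_fun [set x | in_cube x] p ->
  (forall x, in_cube x -> 0 <= p x) ->
  cube_int (fun x => (p x)%:E) = 1%E ->
  (exists M : R, forall x, in_cube x -> p x <= M) ->
  (* rho is a distance between distribution functions on X *)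
  (forall G, is_cdf G -> rho G G = 0) ->
  (forall G H, is_cdf G -> is_cdf H -> 0 <= rho G H) ->
  (forall G H, is_cdf G -> is_cdf H -> rho G H = rho H G) ->
  (forall G H K, is_cdf G -> is_cdf H -> is_cdf K ->
     rho G K <= rho G H + rho H K) ->
  (* measurability of the statistics built from rho (implicit in the paper) *)
  (forall (l : nat) G, is_cdf G ->
     measurable_fun [set u : l.-tuple (r.-tuple R) | in_cubes u]
       (fun u => rho G (ecdf u))) ->
  (forall n l : nat,
     measurable_fun
       [set xz : n.-tuple (r.-tuple R) * l.-tuple (r.-tuple R) |
          in_cubes xz.1 /\ in_cubes xz.2]
       (fun xz => rho (ecdf xz.1) (ecdf xz.2))) ->
  0 < alpha ->
  1 < c ->
  eps @ \oo --> 0 ->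
  (* P(rho(F, \hat F_X) > eps_n / 16) = O(n^{-c}) *)
  (exists (C : R) (N : nat), forall n : nat, (N <= n)%N ->
     (sample_prob p (fun x : n.-tuple (r.-tuple R) =>
        (eps n / 16 < rho (cdf_of_density p) (ecdf x))%R)
      <= (C * n%:R `^ (- c))%:E)%E) ->
  exists (C : R) (N : nat), forall n : nat, (N <= n)%N ->
    (* Delta_{n,k} is a well-defined positive real *)
    has_ubound (sens_set rho n (kn n)) ->
    0 < sensitivity rho n (kn n) ->
    (* R(k, eps_n / 2) > 0 (otherwise the bound is +oo) *)
    (0 < small_ball p rho (kn n) (eps n / 2)%R)%E ->
    (joint_prob p rho alpha n
       (fun z : (kn n).-tuple (r.-tuple R) =>
          (eps n < rho (cdf_of_density p) (ecdf z))%R)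
     <= ((sup [set p x | x in [set x | in_cube x]]) ^+ (kn n) *
           expR (- (3 * alpha * eps n) / (16 * sensitivity rho n (kn n))))%:E
          / small_ball p rho (kn n) (eps n / 2)%R
        + (C * n%:R `^ (- c))%:E)%E.
Proof.
move=> mp p_ge0 p_int p_bdd _ rho_ge0 rho_sym rho_tri rho_meas _ alpha0 _ _.
(* The maximum with 1 ensures a nonempty database, so that [ecdf x] is a cdf. *)
move=> [C [N sample_le]]; exists C, (maxn N 1) => n.
rewrite geq_max => /andP[Nn n_gt0] _ sens0 ball0.
apply: le_trans (joint_prob_le mp p_ge0 p_int p_bdd rho_ge0 rho_sym rho_tri
  rho_meas alpha0 n_gt0 sens0 ball0) _.
by apply: leeD2l; exact: sample_le.
Qed.
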